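(* Let $W_\Gamma$ be the Coxeter group associated to a Coxeter graph $\Gamma$. If there exist two (distinct) non-adjacent even vertices $v,w\in V(\Gamma)$, then the automorphism group $\mathrm{Aut}(W_\Gamma)$ virtually surjects onto $\mathbb{Z}/2\mathbb{Z}*\mathbb{Z}/2\mathbb{Z}$, i.e. some finite index subgroup of $\mathrm{Aut}(W_\Gamma)$ admits a surjective homomorphism onto $\mathbb{Z}/2\mathbb{Z}*\mathbb{Z}/2\mathbb{Z}$. In particular, for every infinite even Coxeter group $W_\Gamma$, the automorphism group $\mathrm{Aut}(W_\Gamma)$ virtually maps onto some infinite Coxeter group, i.e. some finite index subgroup of $\mathrm{Aut}(W_\Gamma)$ admits a surjective homomorphism onto an infinite Coxeter group.
   Context: A Coxeter graph is a finite simplicial graph $\Gamma$ with vertex set $V(\Gamma)$, edge set $E(\Gamma)$ (a set of two-element subsets of $V(\Gamma)$) and an edge-labeling $\varphi\colon E(\Gamma)\to\{2,3,4,\ldots\}$. The associated Coxeter group is $$W_\Gamma=\langle V(\Gamma)\mid v^2 \text{ for all } v\in V(\Gamma),\ (vw)^{\varphi(\{v,w\})}\text{ for all }\{v,w\}\in E(\Gamma)\rangle$$ (there is no relation between $v$ and $w$ when they are not adjacent). A vertex $v\in V(\Gamma)$ is called even if every edge $e\in E(\Gamma)$ with $v\in e$ has an even label. The Coxeter group $W_\Gamma$ is called even if all edge labels of $\Gamma$ are even. *)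

(* Defs.v *)
From HB Require Import structures.
From mathcomp Require Import all_boot.
From mathcomp Require Import boolp classical_sets functions cardinality.

Set Implicit Arguments.
Unset Strict Implicit.
Unset Printing Implicit Defensive.

Local Open Scope classical_set_scope.
Local Open Scope quotient_scope.
Local Open Scope group_scope.

(* The letter [(s, false)] stands for the generator [s], and [(s, true)] for its
   formal inverse. *)
Definition letter (S : Type) := (S * bool)%type.
Definition word (S : Type) := seq (letter S).

Definition gen_letter (S : Type) (s : S) : letter S := (s, false).
Definition inv_letter (S : Type) (x : letter S) : letter S := (x.1, ~~ x.2).
Definition inv_word (S : Type) (u : word S) : word S :=
  rev [seq inv_letter x | x <- u].
Definition exp_word (S : Type) (u : word S) (n : nat) : word S :=
  flatten (nseq n u).

(* The quotient of the monoid of words by this congruence is the quotient of the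
   free group on [S] by the normal closure of [R]. *)
Inductive pres_eq (S : Type) (R : set (word S)) : word S -> word S -> Prop :=
| pres_eq_refl u : pres_eq R u u
| pres_eq_sym u v : pres_eq R u v -> pres_eq R v u
| pres_eq_trans v u w : pres_eq R u v -> pres_eq R v w -> pres_eq R u w
| pres_eq_cat u u' v v' :
    pres_eq R u u' -> pres_eq R v v' -> pres_eq R (u ++ v) (u' ++ v')
| pres_eq_cancel x : pres_eq R [:: x; inv_letter x] [::]
| pres_eq_relator r : R r -> pres_eq R r [::].

Section Presentation.
Variables (S : choiceType) (R : set (word S)).
Implicit Types (u v w : word S) (x : letter S).

Definition pres_rel : rel (word S) := fun u v => `[< pres_eq R u v >].

Fact pres_rel_equiv : equiv_class_of pres_rel.
Proof.
split=> [u|u v|v u w].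
- exact/asboolP/pres_eq_refl.
- by apply/asboolP/asboolP; apply: pres_eq_sym.
- by move=> /asboolP uv /asboolP vw; apply/asboolP/(pres_eq_trans uv vw).
Qed.

Canonical pres_equiv := EquivRelPack pres_rel_equiv.

Definition presented := {eq_quot pres_equiv}.
HB.instance Definition _ := Choice.on presented.
HB.instance Definition _ := EqQuotient.on presented.

Definition pres_class (u : word S) : presented := \pi_presented u.
Definition pres_gen (s : S) : presented := pres_class [:: gen_letter s].

Definition pres_one : presented := pres_class [::].
Definition pres_mul (a b : presented) : presented :=
  pres_class (repr a ++ repr b).
Definition pres_inv (a : presented) : presented :=
  pres_class (inv_word (repr a)).

Lemma pres_classP u v : pres_class u = pres_class v <-> pres_eq R u v.
Proof.
by split=> [/eqmodP/asboolP|uv] //; apply/eqmodP/asboolP.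
Qed.

Lemma repr_pres_class u : pres_eq R (repr (pres_class u)) u.
Proof. by apply/pres_classP; rewrite /pres_class reprK. Qed.

Lemma inv_letterK : involutive (@inv_letter S).
Proof. by case=> s b; rewrite /inv_letter /= negbK. Qed.

Lemma inv_word_cat u v : inv_word (u ++ v) = inv_word v ++ inv_word u.
Proof. by rewrite /inv_word map_cat rev_cat. Qed.

Lemma inv_wordK : involutive (@inv_word S).
Proof.
by move=> u; rewrite /inv_word map_rev revK -map_comp map_id_in // => x _;
  apply: inv_letterK.
Qed.

Lemma pres_eq_catV u : pres_eq R (u ++ inv_word u) [::].
Proof.
elim: u => [|x u IHu]; first exact: pres_eq_refl.
rewrite -cat1s inv_word_cat -catA [X in _ ++ X]catA.
apply: pres_eq_trans (pres_eq_cancel R x).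
rewrite -[X in pres_eq _ _ X]/([:: x] ++ ([::] ++ inv_word [:: x])).
by do !apply: pres_eq_cat => //; apply: pres_eq_refl.
Qed.

Lemma pres_class_cat u v :
  pres_mul (pres_class u) (pres_class v) = pres_class (u ++ v).
Proof. by apply/pres_classP/pres_eq_cat; apply: repr_pres_class. Qed.

Lemma pres_class_surj (a : presented) : exists u, a = pres_class u.
Proof. by exists (repr a); rewrite /pres_class reprK. Qed.

Fact pres_mulA : associative pres_mul.
Proof.
move=> a b c; have [u ->] := pres_class_surj a.
have [v ->] := pres_class_surj b; have [w ->] := pres_class_surj c.
by rewrite !pres_class_cat catA.
Qed.

Fact pres_mul1 : left_id pres_one pres_mul.
Proof. by move=> a; have [u ->] := pres_class_surj a; rewrite pres_class_cat. Qed.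

Fact pres_1mul : right_id pres_one pres_mul.
Proof.
by move=> a; have [u ->] := pres_class_surj a; rewrite pres_class_cat cats0.
Qed.

Fact pres_mulV : right_inverse pres_one pres_inv pres_mul.
Proof.
move=> a; rewrite -[a in LHS]reprK -/(pres_class _) /pres_inv pres_class_cat.
apply/pres_classP; rewrite -/(pres_class _).
by rewrite /pres_class reprK; apply: pres_eq_catV.
Qed.

Fact pres_Vmul : left_inverse pres_one pres_inv pres_mul.
Proof.
move=> a; rewrite -[a in X in pres_mul _ X]reprK -/(pres_class _).
rewrite /pres_inv pres_class_cat; apply/pres_classP.
rewrite -[X in _ ++ X]inv_wordK; exact: pres_eq_catV.
Qed.

HB.instance Definition _ :=
  isGroup.Build presented pres_mulA pres_mul1 pres_1mul pres_Vmul pres_mulV.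

End Presentation.

(* The presentation whose generators are all elements of the two factors and
   whose relators are their multiplication tables. *)
Section FreeProduct.
Variables G H : groupType.

Definition freeprod_relators : set (word (G + H)) :=
  [set r | (exists x y : G, r = [:: gen_letter (inl x); gen_letter (inl y);
                                    inv_letter (gen_letter (inl (x * y)))])
        \/ (exists x y : H, r = [:: gen_letter (inr x); gen_letter (inr y);
                                    inv_letter (gen_letter (inr (x * y)))])].

Definition freeprod : groupType := presented freeprod_relators.

End FreeProduct.

Record groupAut (G : groupType) := GroupAut {
  aut_fun :> G -> G;
  autM : {morph aut_fun : x y / x * y};
  aut_bij : bijective aut_fun
}.

Section AutGroup.
Variable G : groupType.
Implicit Types f g h : groupAut G.

HB.instance Definition _ := gen_eqMixin (groupAut G).
HB.instance Definition _ := gen_choiceMixin (groupAut G).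
HB.instance Definition _ f := isMultiplicative.Build G G f (@autM G f).

Lemma aut_eqP f g : f =1 g -> f = g.
Proof.
case: f g => [f fM f_bij] [g gM g_bij] /= /funext fg; subst g.
by rewrite (Prop_irrelevance fM gM) (Prop_irrelevance f_bij g_bij).
Qed.

Definition aut_one : groupAut G :=
  @GroupAut G id (fun x y => erefl)
    (Bijective (@frefl _ _ id) (@frefl _ _ id)).

Fact aut_mulM f g : {morph f \o g : x y / x * y}.
Proof. by move=> x y /=; rewrite !autM. Qed.

Definition aut_mul f g : groupAut G :=
  @GroupAut G (f \o g) (aut_mulM f g) (bij_comp (aut_bij f) (aut_bij g)).

Fact aut_inv_ex f : exists g : groupAut G, cancel f g /\ cancel g f.
Proof.
have [g fK gK] := aut_bij f.
have gM : {morph g : x y / x * y} by apply: (can2_gmulfM (f := f)).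
by exists (@GroupAut G g gM (Bijective gK fK)).
Qed.

Definition aut_inv f : groupAut G := projT1 (cid (aut_inv_ex f)).

Lemma aut_invK f : cancel f (aut_inv f) /\ cancel (aut_inv f) f.
Proof. by rewrite /aut_inv; case: cid. Qed.

Fact aut_mulA : associative aut_mul.
Proof. by move=> f g h; apply: aut_eqP. Qed.

Fact aut_mul1 : left_id aut_one aut_mul.
Proof. by move=> f; apply: aut_eqP. Qed.

Fact aut_1mul : right_id aut_one aut_mul.
Proof. by move=> f; apply: aut_eqP. Qed.

Fact aut_Vmul : left_inverse aut_one aut_inv aut_mul.
Proof. by move=> f; apply: aut_eqP => x /=; apply: (aut_invK f).1. Qed.

Fact aut_mulV : right_inverse aut_one aut_inv aut_mul.
Proof. by move=> f; apply: aut_eqP => x /=; apply: (aut_invK f).2. Qed.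

HB.instance Definition _ :=
  isGroup.Build (groupAut G) aut_mulA aut_mul1 aut_1mul aut_Vmul aut_mulV.

End AutGroup.

Definition infinite_group (G : groupType) : Prop := infinite_set [set: G].

Definition finite_index (G : groupType) (H : set G) : Prop :=
  finite_set [set [set g * h | h in H] | g in [set: G]].

(* A homomorphism defined on the subgroup [H] is given by a function on all of
   [G], whose values outside [H] are irrelevant. *)
Definition virtually_surjects_onto (G K : groupType) : Prop :=
  exists H : set G,
    [/\ group_closed (mem H), finite_index H
      & exists2 f : G -> K,
          {in H &, {morph f : x y / x * y}} & f @` H = [set: K]].

(* The values of [label] outside [edges] are irrelevant. *)
Record coxeterGraph := CoxeterGraph {
  vertex :> finType;
  edges : {set {set vertex}};
  label : {set vertex} -> nat;
  edges_card2 : forall e, e \in edges -> #|e| = 2;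
  label_ge2 : forall e, e \in edges -> 2 <= label e
}.

Definition adjacent (Gamma : coxeterGraph) (v w : Gamma) : bool :=
  [set v; w]%SET \in edges Gamma.

Definition even_vertex (Gamma : coxeterGraph) (v : Gamma) : Prop :=
  forall e, e \in edges Gamma -> v \in e -> ~~ odd (label e).

Definition even_coxeter (Gamma : coxeterGraph) : Prop :=
  forall e, e \in edges Gamma -> ~~ odd (label e).

Definition coxeter_relators (Gamma : coxeterGraph) : set (word Gamma) :=
  [set r | (exists v : Gamma, r = exp_word [:: gen_letter v] 2)
        \/ (exists2 vw : Gamma * Gamma, adjacent vw.1 vw.2
            & r = exp_word [:: gen_letter vw.1; gen_letter vw.2]
                           (label [set vw.1; vw.2]%SET))].

Definition coxeterGroup (Gamma : coxeterGraph) : groupType :=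
  presented (@coxeter_relators Gamma).

(* Main.v *)
Require Import Defs.
From mathcomp Require Import all_boot all_order all_algebra zify zmodp.
From mathcomp Require Import boolp classical_sets functions cardinality.

(* Let the edges [{i, i + 1}] of the line be coloured by vertices of [Gamma] and
   let a generator [s] of [W] flip all edges coloured [s].  If this respects the
   relations, [W] acts on the line, and the stabilizer of [0] is generated by
   conjugates of generators.  For an [n]-periodic colouring, the elements [g]
   with [n | g 0] form a subgroup mapping to the integers by [g 0 / n], and its
   involutions must fix [0].  Hence an automorphism [f] preserving this subgroup
   preserves the stabilizer of [0] and induces a permutation [f'] of the line
   with [f' (i + n) = f' i + e n], where [e = 1] or [e = -1].  So [f'] acts on
   the coset [1 + n Z], when it preserves it, by an affine map [x |-> e x + p],
   i.e. by an element of the infinite dihedral group; inner automorphisms provide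
   a reflection and a translation.

   For non-adjacent even vertices [v], [w], colour the line alternately by [v]
   and [w].  If [W] is even and [Gamma] is complete, then either the edges with
   label > 2 form a matching, and [W] is finite, or there are edges [{a, b}] and
   [{c, b}] with labels [2 k], [2 l > 2]: then colour the line periodically by
   the word [(b a)^(k-1) (b c)^(l-1)]. *)

Set Implicit Arguments.
Unset Strict Implicit.
Unset Printing Implicit Defensive.

Import Order.TTheory GRing.Theory Num.Theory.
Local Open Scope classical_set_scope.
Local Open Scope ring_scope.

Lemma mul1_invg (G : groupType) (x y : G) : (x * y = 1)%g -> (x^-1 = y)%g.
Proof. by move=> xy; rewrite -[LHS]mulg1 -xy mulKg. Qed.

(** * The infinite dihedral group *)

Section InfiniteDihedral.
Variable K : groupType.
Implicit Types x : K.

Definition zpow x (i : int) : K :=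
  match i with Posz n => (x ^+ n)%g | Negz n => ((x ^+ n.+1)^-1)%g end.

Lemma zpowS x i : zpow x (i + 1) = (x * zpow x i)%g.
Proof.
case: i => [n|[|n]].
- by rewrite -PoszD addn1 /= expgS.
- by rewrite /= expg1 mulgV.
- have -> : Negz n.+1 + 1 = Negz n by lia.
  by rewrite /= [(x ^+ n.+2)%g]expgSr invgM mulgA mulgV mul1g.
Qed.

Lemma zpowP x i : zpow x (i - 1) = (x^-1 * zpow x i)%g.
Proof. by rewrite -[in RHS](subrK 1 i) zpowS mulKg. Qed.

Lemma zpowD x i j : zpow x (i + j) = (zpow x i * zpow x j)%g.
Proof.
elim/int_ind: i => [|n IHn|n IHn]; first by rewrite add0r mul1g.
- by rewrite intS [1 + _]addrC addrAC !zpowS IHn mulgA.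
- have -> : - n.+1%:Z = - n%:Z - 1 by lia.
  by rewrite addrAC !zpowP IHn mulgA.
Qed.

Variables a b : K.
Hypotheses (aa : (a * a = 1)%g) (bb : (b * b = 1)%g).


(** The image in [K] of the affine map [x |-> e x + p] of the integers, [e] being a sign, when
    [x |-> - x] is sent to [a] and [x |-> x + 1] to [a * b]. The lemma [dihedralM] is the
    composition law of such maps. *)
Definition dihedral (e : bool) (p : int) : K :=
  (zpow (a * b) p * if e then 1 else a)%g.

(** As [a] and [b] are involutions, the inverse of [a * b] is [b * a], so conjugation by [a] inverts
    [a * b]. *)
Lemma zpow_flip p : (a * zpow (a * b) p = zpow (a * b) (- p) * a)%g.
Proof.
have abV : ((a * b)^-1 = b * a)%g.
  by apply: mul1_invg; rewrite -mulgA [(b * (b * a))%g]mulgA bb mul1g.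
elim/int_ind: p => [|n IHn|n IHn]; first by rewrite oppr0 mul1g mulg1.
- have -> : - n.+1%:Z = - n%:Z - 1 by lia.
  rewrite zpowP abV -mulgA -IHn intS addrC zpowS.
  by rewrite !mulgA -[(b * a * a)%g]mulgA aa mulg1 mul1g.
- have -> : - n.+1%:Z = - n%:Z - 1 by lia.
  have -> : - (- n%:Z - 1) = - - n%:Z + 1 by lia.
  rewrite zpowP abV zpowS -!mulgA -IHn.
  by rewrite !mulgA.
Qed.

Lemma dihedralM e p e' p' :
  dihedral (e == e') (p + (if e then 1 else -1) * p') =
  (dihedral e p * dihedral e' p')%g.
Proof.
rewrite /dihedral; case: e; case: e' => /=;
  rewrite ?mulN1r ?mul1r zpowD ?mulg1 ?mulgA //.
- by rewrite -[(_ * a * zpow _ p')%g]mulgA zpow_flip !mulgA.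
- by rewrite -[(_ * a * zpow _ p')%g]mulgA zpow_flip -!mulgA aa !mulg1.
Qed.

Lemma dihedral_refl : dihedral false 0 = a.
Proof. by rewrite /dihedral mul1g. Qed.

Lemma dihedral_refl_trans : dihedral false (-1) = b.
Proof.
rewrite /dihedral [zpow _ _]/= expg1 (mul1_invg (y := (b * a)%g)).
  by rewrite -mulgA aa mulg1.
by rewrite -mulgA [(b * (b * a))%g]mulgA bb mul1g.
Qed.

End InfiniteDihedral.

(** * Groups acting on a coloured line *)

Section Flip.
Variables (S : eqType) (c : int -> S).

(* The colour of [i] labels the edge joining [i] and [i + 1]. *)
Definition flip (s : S) (i : int) : int :=
  if c i == s then i + 1 else if c (i - 1) == s then i - 1 else i.

Hypothesis c_adj : forall i, c i != c (i + 1).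

Lemma flip_up i : flip (c i) i = i + 1.
Proof. by rewrite /flip eqxx. Qed.

Lemma flip_down s i : c (i - 1) = s -> flip s i = i - 1.
Proof.
move=> <-; rewrite /flip eqxx ifN //.
by have := c_adj (i - 1); rewrite subrK eq_sym.
Qed.

Lemma flip_fix s i : c i != s -> c (i - 1) != s -> flip s i = i.
Proof. by rewrite /flip => /negPf -> /negPf ->. Qed.

(** Neighbouring edges differ in colour, so the edges coloured [s] are pairwise disjoint and the
    flip swaps the ends of each. *)
Lemma flipK s : involutive (flip s).
Proof.
move=> i; have [<-|ci] := eqVneq (c i) s.
  by rewrite flip_up flip_down addrK.
have [ci'|ci'] := eqVneq (c (i - 1)) s; last by rewrite !flip_fix.
by rewrite (flip_down ci') -ci' flip_up subrK.
Qed.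

(** The reflection [i |-> 1 - i] of the points maps the edge numbered [i] to the edge numbered
    [- i], so it preserves a symmetric colouring. *)
Lemma flip_refl s i : (forall i, c (- i) = c i) -> flip s (1 - i) = 1 - flip s i.
Proof.
move=> c_sym; have c1 : c (1 - i) = c (i - 1) by rewrite -c_sym opprB.
have c0 : c (1 - i - 1) = c i by rewrite addrAC subrr add0r c_sym.
have [ci|ci] := eqVneq (c i) s.
  by rewrite -{2}ci flip_up flip_down ?c0 //; lia.
have [ci'|ci'] := eqVneq (c (i - 1)) s; last by rewrite !flip_fix ?c1 ?c0.
by rewrite (flip_down ci') -ci' -c1 flip_up; lia.
Qed.

Lemma flip_per (n : int) s i :
  (forall i, c (i + n) = c i) -> flip s (i + n) = flip s i + n.
Proof.
by move=> cn; rewrite /flip cn [i + n - 1]addrAC cn; do !case: ifP => _ //; lia.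
Qed.

End Flip.

Lemma finite_index_factor (G : groupType) (H : set G) (T : finType) (F : G -> T) :
    group_closed (mem H) -> (forall x y, F x = F y -> H (x^-1 * y)%g) ->
  finite_index H.
Proof.
move=> Hgrp FH; have HM := group_closedM Hgrp.
have HV := group_closedV Hgrp.
have memH x : (x \in mem H) = (x \in H) by [].
(* Each nonempty fibre of [F] lies in a single left coset, so the coset of [x] is recovered from
   [F x] as the fibre times [H]. *)
pose D := fun t : T => [set x * h | x in [set x | F x = t] & h in H]%g.
apply: (@sub_finite_set _ _ (range D)); last first.
  exact/finite_image/finite_finset.
move=> _ [x _ <-]; exists (F x) => //.
apply/seteqP; split=> [_ [y Fy [h Hh <-]]|_ [h Hh <-]]; last first.
  by exists x => //; exists h.
exists (x^-1 * y * h)%g; last by rewrite !mulgA mulgV mul1g.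
have := HM (x^-1 * y)%g h; rewrite !memH !inE; apply; last exact: Hh.
by apply: FH; rewrite Fy.
Qed.

Lemma aut1 (G : groupType) (f : groupAut G) : f 1%g = 1%g.
Proof. by apply: (mulIg (f 1%g)); rewrite -autM !mul1g. Qed.

Lemma autV (G : groupType) (f : groupAut G) x : f x^-1%g = (f x)^-1%g.
Proof. by apply: (mulIg (f x)); rewrite -autM !mulVg aut1. Qed.

Lemma dvdzD_mull d i q : (d %| i + q * d)%Z = (d %| i)%Z.
Proof. by rewrite rpredDr // dvdz_mull // dvdzz. Qed.

(** * Automorphisms compatible with an action on a periodic line *)

Section LineAction.
Variables (W : groupType) (S : finType) (gen : S -> W).
Hypothesis gen_ind : forall P : W -> Prop, P 1%g ->
  (forall s x, P x -> P (gen s * x)%g) -> forall x, P x.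
Hypothesis genK : forall s, (gen s * gen s = 1)%g.

Variables (c : int -> S) (h : nat) (act : W -> int -> int).
Hypothesis act1 : forall i, act 1%g i = i.
Hypothesis actM : forall x y i, act (x * y)%g i = act x (act y i).
Hypothesis act_gen : forall s i, act (gen s) i = flip c s i.

Hypothesis h_gt0 : (0 < h)%N.
Local Notation n := (2 * h%:Z).
Hypothesis c_adj : forall i, c i != c (i + 1).
Hypothesis c_per : forall i, c (i + n) = c i.
Hypothesis c_sym : forall i, c (- i) = c i.

Variable y : W.
Hypothesis y_even : forall i, act y (2 * i) = 2 * i + n.
Hypothesis y_odd : forall i, act y (2 * i + 1) = 2 * i + 1 - n.

Lemma actK x : cancel (act x) (act x^-1%g).
Proof. by move=> i; rewrite -actM mulVg act1. Qed.

Lemma actVK x : cancel (act x^-1%g) (act x).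
Proof. by move=> i; rewrite -actM mulgV act1. Qed.

Lemma act_per1 x i : act x (i + n) = act x i + n.
Proof.
elim/gen_ind: x i => [|s x IHx] i; first by rewrite !act1.
by rewrite !actM IHx !act_gen flip_per.
Qed.

Lemma act_per x i q : act x (i + q * n) = act x i + q * n.
Proof.
elim/int_ind: q => [|q IHq|q IHq]; first by rewrite mul0r !addr0.
- by rewrite intS mulrDl mul1r addrCA addrC act_per1 IHq -addrA [_ + n]addrC.
- apply: (addIr n); rewrite -act_per1.
  have -> : i + - q.+1%:Z * n + n = i + - q%:Z * n by lia.
  by rewrite IHq; lia.
Qed.

Lemma act_refl x i : act x (1 - i) = 1 - act x i.
Proof.
elim/gen_ind: x i => [|s x IHx] i; first by rewrite !act1.
by rewrite !actM IHx !act_gen flip_refl.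
Qed.

(** Multiplying the generators that colour the edges between 0 and [i] gives a representative of the
    coset of elements carrying 0 to [i]. As [Negz k] is [- k - 1], it numbers the edge joining
    [- k - 1] and [- k]. *)
Definition walk (i : int) : W :=
  match i with
  | Posz m => iteri m (fun k x => gen (c (Posz k)) * x)%g 1%g
  | Negz m => iteri m.+1 (fun k x => gen (c (Negz k)) * x)%g 1%g
  end.

Lemma walkS i : walk (i + 1) = (gen (c i) * walk i)%g.
Proof.
case: i => [k|[|k]]; first by rewrite -PoszD addn1.
- by rewrite /= mulgA genK !mul1g.
- have -> : Negz k.+1 + 1 = Negz k by lia.
  by rewrite [walk (Negz k.+1)]/= mulgA genK mul1g.
Qed.

Lemma act_walk i : act (walk i) 0 = i.
Proof.
elim/int_ind: i => [|i IHi|i IHi]; first exact: act1.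
- by rewrite intS addrC walkS actM IHi act_gen flip_up.
- have := walkS (- i.+1%:Z); have -> : - i.+1%:Z + 1 = - i%:Z by lia.
  move=> /(congr1 (fun x => act x 0)); rewrite IHi actM act_gen.
  move=> /(congr1 (flip c (c (- i.+1%:Z)))); rewrite flipK // => <-.
  by rewrite flip_down //; [lia | congr c; lia].
Qed.

(* The factor [2] in the second component makes the shifts of the elements of
   [line_stab] exhaust the integers: conjugation by [y] shifts by [-2 n]. *)
Definition residue (i : int) : bool * bool := ((n %| i)%Z, (2 * n %| i - 1)%Z).

Definition line_stab : set (groupAut W) :=
  [set f | forall x, residue (act (f x) 0) = residue (act x 0)].

Lemma line_stab_closed : group_closed (mem line_stab).
Proof.
split=> [|f g]; rewrite !inE => Hf; first by [].
move=> Hg x.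
have -> : (f * g^-1)%g x = f ((g^-1)%g x) by [].
rewrite Hf -Hg; congr (residue (act _ 0)).
exact: (aut_invK g).2.
Qed.

(** Residues depend only on the action modulo [2 * n]. By periodicity [W] acts on these [4 * h]
    classes, and the actions of the elements [f^-1 (gen s)] determine the left coset of [f]; only
    finitely many such tables exist. *)
Lemma line_stab_index : finite_index line_stab.
Proof.
have n_gt0 : 0 < 2 * n by lia.
pose N := (4 * h)%N.
have N_gt0 : (0 < N)%N by rewrite /N; lia.
pose red (i : int) : 'I_N := Ordinal (ltn_pmod `|(i %% (2 * n))%Z|%N N_gt0).
(* The difference is written as a sum of two multiples of [n] so that [act_per] applies twice. *)
have red_eq i j : red i = red j -> exists q, i = j + q * n + q * n.
  move=> /(congr1 val) /=; rewrite !modn_small; last 2 first.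
  - have := @ltz_pmod i _ n_gt0; have := @modz_ge0 i (2 * n) _; rewrite /N; lia.
  - have := @ltz_pmod j _ n_gt0; have := @modz_ge0 j (2 * n) _; rewrite /N; lia.
  move=> ij; exists ((i %/ (2 * n))%Z - (j %/ (2 * n))%Z).
  have := divz_eq i (2 * n); have := divz_eq j (2 * n).
  have := @modz_ge0 i (2 * n) _; have := @modz_ge0 j (2 * n) _.
  nia.
pose F (f : groupAut W) : {ffun S -> {ffun 'I_N -> 'I_N}} :=
  [ffun s => [ffun i : 'I_N => red (act ((f^-1)%g (gen s)) (nat_of_ord i)%:Z)]].
apply: (finite_index_factor (F := F)) line_stab_closed _ => f g Fgf.
have red_per i q : red (i + q * n + q * n) = red i.
  have -> : i + q * n + q * n = q * (2 * n) + i by lia.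
  by apply/val_inj; rewrite /= modzMDl.
have act_red x i j : red i = red j -> red (act x i) = red (act x j).
  by move=> /red_eq[q ->]; rewrite !act_per red_per.
have red_val i : red (nat_of_ord (red i))%:Z = red i.
  have i_ge0 : 0 <= (i %% (2 * n))%Z by apply: modz_ge0; lia.
  have i_lt : (`|(i %% (2 * n))%Z| < N)%N.
    by have := @ltz_pmod i _ n_gt0; rewrite /N; lia.
  by apply/val_inj; rewrite /= (modn_small i_lt) gez0_abs // modz_mod modn_small.
have FE x i : red (act ((f^-1)%g x) i) = red (act ((g^-1)%g x) i).
  elim/gen_ind: x => [|s x IHx]; first by rewrite !aut1.
  rewrite !autM !actM (act_red _ _ _ IHx).
  rewrite (act_red _ _ _ (esym (red_val _))).
  rewrite [RHS](act_red _ _ _ (esym (red_val _))).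
  by have := congr1 (fun k : {ffun S -> {ffun 'I_N -> 'I_N}} =>
    k s (red (act ((g^-1)%g x) i))) Fgf; rewrite !ffunE.
move=> x; have -> : (f^-1 * g)%g x = (f^-1)%g (g x) by [].
have := FE (g x) 0; rewrite (aut_invK g).1 => /red_eq[q ->].
rewrite /residue.
have -> : act x 0 + q * n + q * n - 1 = act x 0 - 1 + q * (2 * n) by lia.
by rewrite !dvdzD_mull.
Qed.

Section Induced.
Variable f : groupAut W.
Hypothesis Hf : line_stab f.

Lemma residue_aut x : residue (act (f x) 0) = residue (act x 0).
Proof. exact: Hf. Qed.

(** The image [f x] moves 0 to some multiple [q * n], so by periodicity its square moves 0 to twice
    that multiple; but the square is trivial. *)
Lemma aut_invol_fix x : (x * x = 1)%g -> act x 0 = 0 -> act (f x) 0 = 0.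
Proof.
move=> xx x0; have := residue_aut x.
rewrite x0 /residue dvdz0 => -[/dvdzP[q fq] _].
have : act (f x) (act (f x) 0) = 0 by rewrite -actM -autM xx aut1 act1.
by rewrite fq -[q * n]add0r act_per fq; lia.
Qed.

(* The stabilizer of [0] is generated by conjugates of generators, which are
   involutions. *)
Lemma aut_fix x : act x 0 = 0 -> act (f x) 0 = 0.
Proof.
(* Schreier's argument: [g] is corrected by the representative of its coset, which changes nothing
   when [g] fixes 0. *)
suff fixW g : act (f ((walk (act g 0))^-1 * g)%g) 0 = 0.
  by move=> x0; have := fixW x; rewrite x0 invg1 mul1g.
elim/gen_ind: g => [|s g IHg]; first by rewrite act1 mulg1 invg1 aut1 act1.
rewrite actM act_gen; set i := act g 0.
have -> : ((walk (flip c s i))^-1 * (gen s * g) =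
    ((walk (flip c s i))^-1 * (gen s * walk i)) * ((walk i)^-1 * g))%g.
  by rewrite -!mulgA mulVKg.
(* The Schreier generator of [s] at [i] is trivial when [s] moves [i] along an edge; otherwise it is
   a conjugate of [gen s], an involution fixing 0. *)
rewrite autM actM IHg; have [ci|ci] := eqVneq (c i) s.
  by rewrite -ci flip_up walkS mulVg aut1 act1.
have [ci'|ci'] := eqVneq (c (i - 1)) s.
  rewrite flip_down // -{2}[i](subrK 1) walkS ci' [X in (_ * X)%g]mulgA genK mul1g.
  by rewrite mulVg aut1 act1.
rewrite flip_fix //; apply: aut_invol_fix.
  by rewrite -!mulgA mulVKg [X in (_ * X)%g]mulgA genK mul1g mulVg.
rewrite !actM act_walk act_gen flip_fix // -{2}[i]act_walk actK //.
Qed.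

(** The permutation of the line induced by [f]; by [inducedE], any other element carrying 0 to [i]
    could replace [walk i]. *)
Definition induced (i : int) : int := act (f (walk i)) 0.

Lemma inducedE x : act (f x) 0 = induced (act x 0).
Proof.
set i := act x 0; have : act (f ((walk i)^-1 * x)%g) 0 = 0.
  by apply: aut_fix; rewrite actM -/i -{2}[i]act_walk actK.
rewrite autM autV actM => /(congr1 (act (f (walk i)))).
by rewrite actVK.
Qed.

Lemma induced0 : induced 0 = 0. Proof. by rewrite /induced aut1 act1. Qed.

Lemma induced_period : exists e, induced n = e * n.
Proof.
have := residue_aut (walk n); rewrite -/(induced n) act_walk /residue.
by rewrite dvdzz => -[/dvdzP[e ->] _]; exists e.
Qed.

(** Since [walk i * walk n] carries 0 to [i + n], and [induced n] is a multiple of the period,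
    moving [i] by [n] moves its image by [induced n]. *)
Lemma induced_per i q : induced (i + q * n) = induced i + q * induced n.
Proof.
have [e en] := induced_period.
have add1 j : induced (j + n) = induced j + induced n.
  have -> : j + n = act (walk j * walk n)%g 0.
    by rewrite actM act_walk -{2}[n]mul1r -[1 * n]add0r act_per act_walk mul1r.
  rewrite -inducedE autM actM -/(induced n) en.
  by rewrite -[e * n in LHS]add0r act_per.
elim/int_ind: q i => [|q IHq|q IHq] i; first by rewrite !mul0r !addr0.
- have -> : i + q.+1%:Z * n = i + q%:Z * n + n by lia.
  by rewrite add1 IHq; lia.
- apply: (addIr (induced n)); rewrite -add1.
  have -> : i + - q.+1%:Z * n + n = i + - q%:Z * n by lia.
  by rewrite IHq; lia.
Qed.

Lemma induced1 : exists p, induced 1 = 1 + p * (2 * n).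
Proof.
have := residue_aut (walk 1); rewrite -/(induced 1) act_walk /residue.
by rewrite subrr dvdz0 => -[_ /dvdzP[p def_p]]; exists p; rewrite -def_p; lia.
Qed.

End Induced.

Lemma induced_comp f g i :
  line_stab f -> induced (f * g)%g i = induced f (induced g i).
Proof. by move=> Hf; rewrite -[RHS]inducedE. Qed.

(** Sign and translation part of the affine map attached to [f], the latter in units of [2 * n]; on
    [line_stab] the division in [shift] is exact by [induced1]. *)
Definition positive (f : groupAut W) : bool := induced f n == n.
Definition shift (f : groupAut W) : int := ((induced f 1 - 1) %/ (2 * n))%Z.

(** The multipliers by which [f] and its inverse act on the period are integers with product 1. *)
Lemma induced_n f : line_stab f -> induced f n = (if positive f then 1 else -1) * n.
Proof.
move=> Hf; have Hf' : line_stab (f^-1)%g.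
  have fH : f \in mem line_stab by rewrite inE.
  by have := group_closedV line_stab_closed fH; rewrite inE.
have [e en] := induced_period Hf; have [e' en'] := induced_period Hf'.
have : induced (f^-1 * f)%g n = n by rewrite mulVg -{2}[n]act_walk.
rewrite induced_comp // en -[e * n]add0r induced_per // induced0 en'.
rewrite /positive en; case: eqP => [->|ne] ee'; first by rewrite mul1r.
have ee1 : e' * e = 1.
  have n0 : n != 0 by lia.
  by apply: (mulIf n0); rewrite mul1r -[RHS]ee'; lia.
have : e == 1 \/ e == -1 by apply/orP; apply: intUnitRing.unitzPl ee1.
by case=> /eqP e1; [case: ne; rewrite e1; lia | rewrite e1; lia].
Qed.

Lemma induced_1 f : line_stab f -> induced f 1 = 1 + shift f * (2 * n).
Proof.
move=> Hf; have [p fp] := induced1 Hf; rewrite /shift fp addrAC subrr add0r.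
by rewrite mulzK //; lia.
Qed.

Lemma positiveM f g : line_stab f -> line_stab g ->
  positive (f * g)%g = (positive f == positive g).
Proof.
move=> Hf Hg; rewrite {1}/positive induced_comp // (induced_n Hg).
rewrite -[X in induced f X]add0r induced_per // induced0 induced_n //.
by case: (positive f); case: (positive g); lia.
Qed.

Lemma shiftM f g : line_stab f -> line_stab g ->
  shift (f * g)%g = shift f + (if positive f then 1 else -1) * shift g.
Proof.
move=> Hf Hg; rewrite {1}/shift induced_comp // (induced_1 Hg).
have -> : 1 + shift g * (2 * n) = 1 + shift g * 2 * n by lia.
rewrite induced_per // induced_n // induced_1 //.
set e := (if positive f then 1 else -1).
have -> : 1 + shift f * (2 * n) + shift g * 2 * (e * n) - 1 =
  (shift f + e * shift g) * (2 * n) by lia.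
by rewrite mulzK //; lia.
Qed.

Lemma line_stab_conj x :
  (forall g, residue (act (x * g * x^-1)%g 0) = residue (act g 0)) ->
  exists f, [/\ line_stab f, induced f n = act (x * walk n * x^-1)%g 0
    & induced f 1 = act (x * walk 1 * x^-1)%g 0].
Proof.
move=> Hx.
have fM : {morph (fun g => x * g * x^-1)%g : g g' / (g * g')%g}.
  by move=> g g'; rewrite -!mulgA mulKg.
have fbij : bijective (fun g => x * g * x^-1)%g.
  exists (fun g => x^-1 * g * x)%g => g;
    by rewrite -!mulgA ?mulKg ?mulVKg ?mulVg ?mulgV mulg1.
by exists (GroupAut fM fbij).
Qed.

(** Conjugation by [s = gen (c 0)] works: it replaces [g 0] by [s (g 1)], which is [s (1 - g 0)].
    This map negates the multiples of [n], because their edges share the colour of edge 0, and it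
    exchanges [1 + 2 q n] with [1 - 2 q n]. *)
Lemma line_stab_refl :
  exists f, [/\ line_stab f, positive f = false & shift f = 0].
Proof.
pose s := gen (c 0).
have sV : (s^-1)%g = s by apply/mul1_invg/genK.
have c0 q : c (q * n) = c 0.
  elim/int_ind: q => [|q IHq|q IHq]; first by rewrite mul0r.
    have -> : q.+1%:Z * n = q%:Z * n + n by lia.
    by rewrite c_per.
  by rewrite -IHq -(c_per (- q.+1%:Z * n)); congr c; lia.
pose k i := flip c (c 0) (1 - i).
have kK i : k (k i) = i by rewrite /k -flip_refl // flipK // opprB addrC subrK.
have k_res i : residue (k i) = residue i.
  have k_n q : k (q * n) = - q * n.
    rewrite /k flip_down //; first by lia.
    by rewrite -(c0 (- q)); congr c; lia.
  have k_1 q : k (1 + q * (2 * n)) = 1 - q * (2 * n).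
    rewrite /k -(c0 (- q * 2)).
    have -> : 1 - (1 + q * (2 * n)) = - q * 2 * n by lia.
    by rewrite flip_up; lia.
  congr pair; apply/idP/idP => /dvdzP[q def_q].
  - by rewrite -(kK i) def_q k_n dvdz_mull.
  - by rewrite def_q k_n dvdz_mull.
  - have ki : k i = 1 + q * (2 * n) by lia.
    by rewrite -(kK i) ki k_1 addrAC subrr add0r -mulNr dvdz_mull.
  - have -> : i = 1 + q * (2 * n) by lia.
    by rewrite k_1 addrAC subrr add0r -mulNr dvdz_mull.
have kE g : act (s * g * s^-1)%g 0 = k (act g 0).
  rewrite sV !actM act_gen /k -act_refl subr0; congr (flip _ _ (act _ _)).
  by rewrite act_gen flip_up.
have [f [Hf fn f1]] : exists f, [/\ line_stab f,
    induced f n = act (s * walk n * s^-1)%g 0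
  & induced f 1 = act (s * walk 1 * s^-1)%g 0].
  by apply: line_stab_conj => g; rewrite kE k_res.
exists f; split=> //.
  rewrite /positive fn kE act_walk -[in k _](mul1r n).
  have -> : k (1 * n) = - n.
    rewrite /k flip_down //; first by lia.
    by rewrite -(c0 (- 1)); congr c; lia.
  lia.
rewrite /shift f1 kE act_walk /k subrr -[X in flip _ _ X](mul0r n).
by rewrite -(c0 0) flip_up mul0r add0r subrr div0z.
Qed.

(** Conjugation by [y] works: [y^-1] moves 0 to [- n], and [n] is even, so the two moves by [n]
    cancel at even points and add up to [- 2 n] at odd ones. *)
Lemma line_stab_trans :
  exists f, [/\ line_stab f, positive f = true & shift f = -1].
Proof.
have yVE : act y^-1%g 0 = - n.
  by rewrite -[RHS](actK y); congr act; rewrite -mulrN y_even; lia.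
have yE i : act y i = if (2 %| i)%Z then i + n else i - n.
  case: ifPn => [/dvdzP[q ->]|i2]; first by rewrite mulrC y_even.
  have [q ->] : exists q, i = 2 * q + 1.
    exists (i %/ 2)%Z; lia.
  exact: y_odd.
have kE g : act (y * g * y^-1)%g 0 =
    if (2 %| act g 0)%Z then act g 0 else act g 0 - 2 * n.
  have -> : act (y * g * y^-1)%g 0 = act y (act g 0 + -1 * n).
    by rewrite !actM yVE (_ : - n = 0 + -1 * n) ?act_per //; lia.
  rewrite act_per yE.
  by case: ifP => _; lia.
have [f [Hf fn f1]] : exists f, [/\ line_stab f,
    induced f n = act (y * walk n * y^-1)%g 0
  & induced f 1 = act (y * walk 1 * y^-1)%g 0].
  apply: line_stab_conj => g; rewrite kE; case: ifP => // _.
  rewrite /residue; congr pair.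
    by rewrite rpredBr // dvdz_mull.
  by rewrite addrAC rpredBr.
exists f; split=> //.
  by rewrite /positive fn kE act_walk (dvdz_mulr h%:Z (dvdzz 2)) eqxx.
rewrite /shift f1 kE act_walk /=; have -> : 1 - 2 * n - 1 = -1 * (2 * n) by lia.
by rewrite mulzK //; lia.
Qed.

(** The induction principle assumed of [K] says that the involutions [a] and [b] generate it; this
    treats the free product and the Coxeter group of an edgeless graph alike. *)
Theorem line_virtually_surjects (K : groupType) (a b : K) :
    (a * a = 1)%g -> (b * b = 1)%g ->
    (forall P : K -> Prop, P 1%g -> (forall x, P x -> P (a * x)%g) ->
      (forall x, P x -> P (b * x)%g) -> forall x, P x) ->
  virtually_surjects_onto (groupAut W) K.
Proof.
move=> aa bb Kind; exists line_stab; split.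
- exact: line_stab_closed.
- exact: line_stab_index.
pose F f := dihedral a b (positive f) (shift f).
have HM f g : line_stab f -> line_stab g -> line_stab (f * g)%g.
  move=> Hf Hg; have [fH gH] : f \in mem line_stab /\ g \in mem line_stab.
    by rewrite !inE.
  by have := group_closedM line_stab_closed fH gH; rewrite inE.
have FM f g : line_stab f -> line_stab g -> F (f * g)%g = (F f * F g)%g.
  by move=> Hf Hg; rewrite /F positiveM // shiftM // dihedralM.
exists F; first by move=> f g; rewrite !inE; apply: FM.
apply/seteqP; split=> // x _.
have [r [Hr r_pos r_sh]] := line_stab_refl.
have [t [Ht t_pos t_sh]] := line_stab_trans.
have Fr : F r = a by rewrite /F r_pos r_sh dihedral_refl.
(* The composite corresponds to [x |-> - x - 1]. *)
have Ftr : F (t * r)%g = b.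
  rewrite /F positiveM // shiftM // t_pos t_sh r_pos r_sh mulr0 addr0.
  exact: dihedral_refl_trans.
elim/Kind: x => [|x [f Hf <-]|x [f Hf <-]].
- by exists (r * r)%g; [exact: HM|rewrite FM // Fr].
- by exists (r * f)%g; [exact: HM|rewrite FM // Fr].
- have Htr := HM _ _ Ht Hr.
  by exists (t * r * f)%g; [exact: HM|rewrite FM // Ftr].
Qed.

End LineAction.

(** * Coxeter groups acting on a line *)

Section PresentedGroups.
Variables (S : choiceType) (R : set (word S)).

Lemma pres_class_letter (s : S) b :
  pres_class R [:: (s, b)] = if b then ((pres_gen R s)^-1)%g else pres_gen R s.
Proof.
case: b => //; apply: (mulgI (pres_gen R s)); rewrite mulgV.
rewrite -[LHS]/(pres_mul _ _) pres_class_cat.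
by apply/pres_classP; apply: (pres_eq_cancel R (gen_letter s)).
Qed.

Lemma pres_ind (P : presented R -> Prop) : P 1%g ->
    (forall s x, P x -> P (pres_gen R s * x)%g) ->
    (forall s x, P x -> P ((pres_gen R s)^-1 * x)%g) -> forall x, P x.
Proof.
move=> P1 PM PV x; have [u ->] := pres_class_surj x.
elim: u => [|[s b] u IHu]; first exact: P1.
rewrite -cat1s -pres_class_cat pres_class_letter.
by case: b; [apply: PV | apply: PM].
Qed.

Variable c : int -> S.

(** The exponent of a letter can be ignored because flips are involutions. *)
Definition word_flip (u : word S) (i : int) : int :=
  foldr (fun x => flip c x.1) i u.

Lemma word_flip_cat u v i : word_flip (u ++ v) i = word_flip u (word_flip v i).
Proof. exact: foldr_cat. Qed.

Lemma word_flip_exp u m i : word_flip (exp_word u m) i = iter m (word_flip u) i.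
Proof. by elim: m => //= m IHm; rewrite /exp_word /= word_flip_cat IHm. Qed.

Hypothesis c_adj : forall i, c i != c (i + 1).
Hypothesis relator_flip : forall r, R r -> forall i, word_flip r i = i.

Lemma word_flip_pres u v : pres_eq R u v -> word_flip u =1 word_flip v.
Proof.
elim=> {u v} [u|u v _ IH|u v w _ IHu _ IHv|u u' v v' _ IHu _ IHv|x|r Rr] i //.
- by rewrite IHu IHv.
- by rewrite !word_flip_cat IHu IHv.
- by rewrite /= flipK.
- exact: relator_flip.
Qed.

Definition line_act (x : presented R) : int -> int := word_flip (repr x).

Lemma line_act_class u : line_act (pres_class R u) =1 word_flip u.
Proof. exact/word_flip_pres/repr_pres_class. Qed.

Lemma line_act1 i : line_act 1%g i = i.
Proof. exact: (line_act_class [::]). Qed.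

Lemma line_actM x y i : line_act (x * y)%g i = line_act x (line_act y i).
Proof.
have [u ->] := pres_class_surj x; have [v ->] := pres_class_surj y.
rewrite -[(pres_class R u * _)%g]/(pres_mul _ _) pres_class_cat.
by rewrite !line_act_class word_flip_cat.
Qed.

Lemma line_act_gen s i : line_act (pres_gen R s) i = flip c s i.
Proof. exact: line_act_class. Qed.

End PresentedGroups.

Section CoxeterLine.
Variable Gamma : coxeterGraph.
Local Notation W := (coxeterGroup Gamma).
Local Notation gen := (pres_gen (@coxeter_relators Gamma)).

Lemma coxeter_genK (s : Gamma) : (gen s * gen s = 1)%g.
Proof.
rewrite -[LHS]/(pres_mul _ _) pres_class_cat; apply/pres_classP.
by apply: pres_eq_relator; left; exists s.
Qed.

Lemma coxeter_ind (P : W -> Prop) : P 1%g ->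
  (forall s x, P x -> P (gen s * x)%g) -> forall x, P x.
Proof.
move=> P1 PM; apply: pres_ind => // s x Px.
by rewrite (mul1_invg (coxeter_genK s)); apply: PM.
Qed.

Lemma coxeter_relation (s t : Gamma) : adjacent s t ->
  ((gen s * gen t) ^+ label [set s; t]%SET = 1)%g.
Proof.
move=> st; rewrite -[(gen s * _)%g]/(pres_mul _ _) pres_class_cat.
have expE u m : (pres_class (@coxeter_relators Gamma) u ^+ m)%g =
    pres_class (@coxeter_relators Gamma) (exp_word u m).
  by elim: m => //= m IHm; rewrite expgS IHm /exp_word /= -pres_class_cat.
rewrite expE; apply/pres_classP/pres_eq_relator; right.
by exists (s, t).
Qed.

Variable c : int -> Gamma.
Hypothesis c_adj : forall i, c i != c (i + 1).
Hypothesis c_rel : forall s t : Gamma, adjacent s t ->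
  forall i, iter (label [set s; t]%SET) (flip c s \o flip c t) i = i.

Lemma coxeter_relator_flip r :
  coxeter_relators r -> forall i, word_flip c r i = i.
Proof.
move=> [[s ->]|[[s t] /= st ->]] i; rewrite word_flip_exp.
  by rewrite /= flipK.
by rewrite -[RHS](c_rel st).
Qed.

Local Notation act := (@line_act _ (@coxeter_relators Gamma) c).

Variable h : nat.
Hypothesis h_gt0 : (0 < h)%N.
Hypothesis c_per : forall i, c (i + 2 * h%:Z) = c i.
Hypothesis c_sym : forall i, c (- i) = c i.

Variables x y : W.
Hypothesis flip_even_e : forall i, act x (2 * i) = 2 * i + 1.
Hypothesis flip_even_o : forall i, act x (2 * i + 1) = 2 * i.
Hypothesis flip_odd_e : forall i, act y (2 * i) = 2 * i - 1.
Hypothesis flip_odd_o : forall i, act y (2 * i + 1) = 2 * i + 2.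

(** The elements [x] and [y] swap the ends of all even and of all odd edges, so [y * x] moves even
    points by 2 and odd points by -2. Its power of exponent [h] is then the element required by
    [line_virtually_surjects]. *)
Lemma coxeter_line_virtually_surjects (K : groupType) (a b : K) :
    (a * a = 1)%g -> (b * b = 1)%g ->
    (forall P : K -> Prop, P 1%g -> (forall x, P x -> P (a * x)%g) ->
      (forall x, P x -> P (b * x)%g) -> forall x, P x) ->
  virtually_surjects_onto (groupAut W) K.
Proof.
have actM := line_actM c_adj coxeter_relator_flip.
have act1 := line_act1 c_adj coxeter_relator_flip.
have actg := line_act_gen c_adj coxeter_relator_flip.
have yE m i : act ((y * x) ^+ m)%g (2 * i) = 2 * i + 2 * m%:Z.
  elim: m => [|m IHm]; first by rewrite act1; lia.
  rewrite expgS 2!actM IHm.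
  have -> : 2 * i + 2 * m%:Z = 2 * (i + m%:Z) by lia.
  by rewrite flip_even_e flip_odd_o; lia.
have yO m i : act ((y * x) ^+ m)%g (2 * i + 1) = 2 * i + 1 - 2 * m%:Z.
  elim: m => [|m IHm]; first by rewrite act1; lia.
  rewrite expgS 2!actM IHm.
  have -> : 2 * i + 1 - 2 * m%:Z = 2 * (i - m%:Z) + 1 by lia.
  by rewrite flip_even_o flip_odd_e; lia.
exact: (line_virtually_surjects coxeter_ind coxeter_genK act1 actM actg h_gt0
  c_adj c_per c_sym (yE h) (yO h)).
Qed.

End CoxeterLine.

(** * Orders of products of two involutions *)

Lemma iter_invol_swap (A : Type) (f g : A -> A) m :
  involutive f -> involutive g ->
  (forall i, iter m (f \o g) i = i) -> forall i, iter m (g \o f) i = i.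
Proof.
(* Conjugation by [f] turns [f \o g] into [g \o f]. *)
move=> fK gK fg i; rewrite -[RHS](fK i) -[X in _ = f X]fg.
elim: m i {fg} => [|m IHm] i; first by rewrite /= fK.
by rewrite iterS IHm /= fK.
Qed.

Lemma iter_fix (A : Type) (f : A -> A) m i : f i = i -> iter m f i = i.
Proof. by move=> fi; elim: m => //= m ->. Qed.

Lemma iter_even_fix (A : Type) (f : A -> A) m i :
  ~~ odd m -> f (f i) = i -> iter m f i = i.
Proof.
move=> m_even ffi; rewrite -[m]even_halfK // -muln2 iterM.
exact: iter_fix.
Qed.

(* [f] and [g] act on the path [p, p + 1, ..., p + 2 k - 1] as the two
   generators of a dihedral group: [g] flips the first, the third, ... edge
   and [f] the other ones, so that [f \o g] permutes the path cyclically. *)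
Lemma iter_path (f g : int -> int) (p : int) (k : nat) :
    f p = p -> f (p + 2 * k%:Z - 1) = p + 2 * k%:Z - 1 ->
    (forall j, (j < k)%N -> g (p + 2 * j%:Z) = p + 2 * j%:Z + 1
                          /\ g (p + 2 * j%:Z + 1) = p + 2 * j%:Z) ->
    (forall j, (j.+1 < k)%N -> f (p + 2 * j%:Z + 1) = p + 2 * j%:Z + 2
                          /\ f (p + 2 * j%:Z + 2) = p + 2 * j%:Z + 1) ->
  forall i, p <= i < p + 2 * k%:Z -> iter k.*2 (f \o g) i = i.
Proof.
case: k => [|k] fp fq gE fE i ip; first lia.
(* The orbit of [p] climbs through the even offsets, turns at the upper end, which [f] fixes, and
   descends through the odd offsets, so it covers the path. *)
have up j : (j < k.+1)%N -> iter j (f \o g) p = p + 2 * j%:Z.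
  elim: j => [|j IHj] jk; first by rewrite mulr0 addr0.
  rewrite iterS IHj; last lia.
  by rewrite /= (gE j _).1 ?(fE j _).1; lia.
have turn : iter k.+1 (f \o g) p = p + 2 * k.+1%:Z - 1.
  rewrite iterS up /= ?(gE _ _).1; try lia.
  by rewrite -[RHS]fq; congr f; lia.
have down j : (j < k.+1)%N ->
    iter j (f \o g) (p + 2 * k.+1%:Z - 1) = p + 2 * k.+1%:Z - 1 - 2 * j%:Z.
  elim: j => [|j IHj] jk; first by rewrite mulr0 subr0.
  rewrite iterS IHj; last lia.
  have -> : p + 2 * k.+1%:Z - 1 - 2 * j%:Z = p + 2 * (k - j)%N%:Z + 1 by lia.
  rewrite /= (gE _ _).2; last lia.
  have -> : p + 2 * (k - j)%N%:Z = p + 2 * (k - j.+1)%N%:Z + 2 by lia.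
  by rewrite (fE _ _).2; lia.
have back : iter k.+1 (f \o g) (p + 2 * k.+1%:Z - 1) = p.
  rewrite iterS down; last lia.
  have -> : p + 2 * k.+1%:Z - 1 - 2 * k%:Z = p + 2 * 0%N%:Z + 1 by lia.
  by rewrite /= (gE 0%N _).2 ?mulr0 ?addr0.
have per : iter k.+1.*2 (f \o g) p = p by rewrite -addnn iterD turn back.
have [j ->] : exists j, i = iter j (f \o g) p.
  have [/dvdzP[q qE]|i2] := boolP (2 %| i - p)%Z.
    exists `|q|%N; rewrite up; lia.
  exists (`|((p + 2 * k.+1%:Z - 1 - i) %/ 2)%Z| + k.+1)%N.
  by rewrite iterD turn down; lia.
by rewrite -iterD addnC iterD per.
Qed.

(** * Two non-adjacent even vertices *)

Definition alternating (S : Type) (v w : S) (i : int) : S :=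
  if (2 %| i)%Z then v else w.

Lemma adjacent_neq (Gamma : coxeterGraph) (s t : Gamma) : adjacent s t -> s != t.
Proof. by move=> /edges_card2; rewrite cards2; case: eqP. Qed.

(** An edge of [Gamma] contains at most one of [v] and [w]. Its other end acts trivially on the
    alternating line, so the product of the two flips is an involution or trivial, and in the first
    case the label is even. *)
Lemma nonadjacent_virtually_surjects (Gamma : coxeterGraph) (v w : Gamma) :
    v != w -> ~~ adjacent v w -> even_vertex v -> even_vertex w ->
  forall (K : groupType) (a b : K), (a * a = 1)%g -> (b * b = 1)%g ->
    (forall P : K -> Prop, P 1%g -> (forall x, P x -> P (a * x)%g) ->
      (forall x, P x -> P (b * x)%g) -> forall x, P x) ->
  virtually_surjects_onto (groupAut (coxeterGroup Gamma)) K.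
Proof.
move=> vw nadj v_even w_even K a b.
pose c := alternating v w.
have c_adj i : c i != c (i + 1).
  rewrite /c /alternating.
  have -> : (2 %| i + 1)%Z = ~~ (2 %| i)%Z by lia.
  by case: (2 %| i)%Z; rewrite //= eq_sym.
have c_id s i : s != v -> s != w -> flip c s i = i.
  move=> sv sw; apply: flip_fix; rewrite /c /alternating; case: ifP; rewrite eq_sym //.
have c_rel (s t : Gamma) : adjacent s t ->
    forall i, iter (label [set s; t]%SET) (flip c s \o flip c t) i = i.
  move=> st i; have st_ne := adjacent_neq st.
  have even_label u : u \in [set s; t]%SET -> (u == v) || (u == w) ->
      ~~ odd (label [set s; t]%SET).
    by move=> ust /orP[] /eqP uE; [apply: v_even|apply: w_even]; rewrite -?uE.
  have [s_vw|] := boolP ((s == v) || (s == w)).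
    have t_id j : flip c t j = j.
      apply: c_id; apply/eqP => tE; move: s_vw st nadj st_ne;
      rewrite tE => /orP[] /eqP ->;
        by rewrite /adjacent ?eqxx // 1?finset.setUC => ->.
    apply: iter_even_fix; first by apply: even_label s_vw; rewrite !inE eqxx.
    by rewrite /= !t_id flipK.
  rewrite negb_or => /andP[sv sw].
  have [t_vw|] := boolP ((t == v) || (t == w)).
    apply: iter_even_fix; first by apply: even_label t_vw; rewrite !inE eqxx orbT.
    by rewrite /= !(c_id s) // flipK.
  rewrite negb_or => /andP[tv tw].
  by apply: iter_fix; rewrite /= !c_id.
have act_gen := line_act_gen c_adj (coxeter_relator_flip c_adj c_rel).
have c_up s i : c i = s -> flip c s i = i + 1 by move=> <-; rewrite flip_up.
have c_down s i : c (i - 1) = s -> flip c s i = i - 1 by apply: flip_down.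
have even2 i : (2 %| 2 * i)%Z = true by lia.
have odd2 i : (2 %| 2 * i + 1)%Z = false by lia.
have odd2' i : (2 %| 2 * i - 1)%Z = false by lia.
apply: (coxeter_line_virtually_surjects c_adj c_rel (h := 1) isT _ _
  (x := pres_gen _ v) (y := pres_gen _ w)) => //.
- by move=> i; rewrite /c /alternating; congr (if _ then _ else _); lia.
- by move=> i; rewrite /c /alternating; congr (if _ then _ else _); lia.
- by move=> i; rewrite act_gen c_up // /c /alternating even2.
- by move=> i; rewrite act_gen c_down ?addrK // /c /alternating even2.
- by move=> i; rewrite act_gen c_down // /c /alternating odd2'.
- move=> i; rewrite act_gen c_up; first by rewrite -addrA.
  by rewrite /c /alternating odd2.
Qed.

(** * Two edges with a common vertex and labels above 2 *)

Section TwoRuns.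
Variables (S : eqType) (b : S).

(* Period of length [2 (k + l - 2)]: the even edges are coloured [b], and the
   odd ones [k - 1] times [a], then [l - 1] times [c]. *)
Definition two_runs (k l : nat) (a c : S) (i : int) : S :=
  if (2 %| i)%Z then b
  else if (i %% (2 * (k + l - 2)%N%:Z))%Z < 2 * k%:Z - 2 then a else c.

Lemma two_runsE k l a c q r : 0 <= r < 2 * (k + l - 2)%N%:Z ->
  two_runs k l a c (q * (2 * (k + l - 2)%N%:Z) + r) =
  if (2 %| r)%Z then b else if r < 2 * k%:Z - 2 then a else c.
Proof.
move=> r_bd; rewrite /two_runs modzMDl modz_small //.
congr (if _ then _ else _).
have -> : q * (2 * (k + l - 2)%N%:Z) = 2 * (q * (k + l - 2)%N%:Z) by lia.
by lia.
Qed.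

Lemma period_decomp (n : nat) (i : int) : (0 < n)%N ->
  exists q r, i = q * (2 * n%:Z) + r /\ 0 <= r < 2 * n%:Z.
Proof.
move=> n_gt0; exists (i %/ (2 * n%:Z))%Z, (i %% (2 * n%:Z))%Z; split.
  exact: divz_eq.
by rewrite modz_ge0 ?ltz_pmod //; lia.
Qed.

(** Moving the origin to the start of the run of [c] exchanges the two runs; the relation between
    [c] and [b] thus follows from that between [a] and [b]. *)
Lemma two_runs_swap k l a c i : (1 < k)%N -> (1 < l)%N ->
  two_runs k l a c (i + (2 * k%:Z - 2)) = two_runs l k c a i.
Proof.
move=> k1 l1; have n_gt0 : (0 < k + l - 2)%N by lia.
have [q [r [-> r_bd]]] := period_decomp i n_gt0.
have lk : (l + k - 2 = k + l - 2)%N by lia.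
rewrite -[in RHS]lk two_runsE ?lk //.
have [r_lt|r_ge] := ltP r (2 * l%:Z - 2).
  rewrite -addrA two_runsE; last lia.
  have -> : (2 %| r + (2 * k%:Z - 2))%Z = (2 %| r)%Z by lia.
  by case: ifP => // _; case: ifP => //; lia.
have -> : q * (2 * (k + l - 2)%N%:Z) + r + (2 * k%:Z - 2) =
  (q + 1) * (2 * (k + l - 2)%N%:Z) + (r - (2 * l%:Z - 2)) by lia.
rewrite two_runsE; last lia.
have -> : (2 %| r - (2 * l%:Z - 2))%Z = (2 %| r)%Z by lia.
by case: ifP => // _; case: ifP => //; lia.
Qed.

Lemma two_runs_per k l a c i : (1 < k)%N -> (1 < l)%N ->
  two_runs k l a c (i + 2 * (k + l - 2)%N%:Z) = two_runs k l a c i.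
Proof.
move=> k1 l1; have n_gt0 : (0 < k + l - 2)%N by lia.
have [q [r [-> r_bd]]] := period_decomp i n_gt0.
have -> : q * (2 * (k + l - 2)%N%:Z) + r + 2 * (k + l - 2)%N%:Z =
  (q + 1) * (2 * (k + l - 2)%N%:Z) + r by lia.
by rewrite !two_runsE.
Qed.

(** The reflection preserves parity and reverses the run of [a], hence modulo the period also the
    run of [c]. *)
Lemma two_runs_sym k l a c i : (1 < k)%N -> (1 < l)%N ->
  two_runs k l a c (2 * k%:Z - 2 - i) = two_runs k l a c i.
Proof.
move=> k1 l1; have n_gt0 : (0 < k + l - 2)%N by lia.
have [q [r [-> r_bd]]] := period_decomp i n_gt0.
rewrite [RHS]two_runsE //.
have [r_lt|r_ge] := leP r (2 * k%:Z - 2).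
  have -> : 2 * k%:Z - 2 - (q * (2 * (k + l - 2)%N%:Z) + r) =
    - q * (2 * (k + l - 2)%N%:Z) + (2 * k%:Z - 2 - r) by lia.
  rewrite two_runsE; last lia.
  have -> : (2 %| 2 * k%:Z - 2 - r)%Z = (2 %| r)%Z by lia.
  by case: ifP => // ?; case: ifP => ?; case: ifP => //; lia.
have -> : 2 * k%:Z - 2 - (q * (2 * (k + l - 2)%N%:Z) + r) =
  (- q - 1) * (2 * (k + l - 2)%N%:Z) + (2 * (k + l - 2)%N%:Z + (2 * k%:Z - 2 - r)) by lia.
rewrite two_runsE; last lia.
have -> : (2 %| 2 * (k + l - 2)%N%:Z + (2 * k%:Z - 2 - r))%Z = (2 %| r)%Z by lia.
by case: ifP => // ?; case: ifP => ?; case: ifP => //; lia.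
Qed.

Lemma two_runs_adj k l a c i : a != b -> c != b ->
  two_runs k l a c i != two_runs k l a c (i + 1).
Proof.
move=> ab cb; rewrite /two_runs.
have -> : (2 %| i + 1)%Z = ~~ (2 %| i)%Z by lia.
by case: (2 %| i)%Z => /=; case: ifP; rewrite // eq_sym.
Qed.

(** In each period the edges coloured [b, a, b, ..., a, b] around the run of [a] form a path of
    [2 k] points bounded by edges coloured [c], and [iter_path] applies. Elsewhere only [b] acts, as
    an involution. *)
Lemma two_runs_order k l a c i : (1 < k)%N -> (1 < l)%N ->
    a != b -> c != b -> a != c ->
  iter k.*2 (flip (two_runs k l a c) a \o flip (two_runs k l a c) b) i = i.
Proof.
move=> k1 l1 ab cb ac; have n_gt0 : (0 < k + l - 2)%N by lia.
have [ba [bc ca]] : b != a /\ b != c /\ c != a by rewrite ![b == _]eq_sym [c == a]eq_sym.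
set col := two_runs k l a c; set f := flip col a; set g := flip col b.
have adj j : col j != col (j + 1) by apply: two_runs_adj.
have [q [r [def_i r_bd]]] := period_decomp i n_gt0.
set p := q * (2 * (k + l - 2)%N%:Z) in def_i.
have colE s : 0 <= s < 2 * (k + l - 2)%N%:Z ->
    col (p + s) = if (2 %| s)%Z then b else if s < 2 * k%:Z - 2 then a else c.
  exact: two_runsE.
have colV : col (p - 1) = c.
  have -> : p - 1 = (q - 1) * (2 * (k + l - 2)%N%:Z) + (2 * (k + l - 2)%N%:Z - 1).
    by rewrite /p; lia.
  by rewrite /col two_runsE; [case: ifP => [|_]; [lia | case: ifP => //; lia] | lia].
have g_up s : 0 <= s < 2 * (k + l - 2)%N%:Z -> (2 %| s)%Z -> g (p + s) = p + s + 1.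
  by move=> s_bd s2; rewrite /g -{1}(_ : col (p + s) = b) ?flip_up // colE // s2.
have g_down s : 0 <= s < 2 * (k + l - 2)%N%:Z -> (2 %| s)%Z -> g (p + s + 1) = p + s.
  by move=> s_bd s2; rewrite -g_up // /g flipK.
have f_fix s : 0 <= s < 2 * (k + l - 2)%N%:Z -> s = 0 \/ 2 * k%:Z - 1 <= s ->
    f (p + s) = p + s.
  move=> s_bd s_out; apply: flip_fix.
    by rewrite colE //; case: ifP => // ?; case: ifP => //; lia.
  have [-> | s_ne] := eqVneq s 0; first by rewrite addr0 colV.
  rewrite -addrA colE; last lia.
  by case: ifP => // ?; case: ifP => //; lia.
have [r_in|r_out] := ltP r (2 * k%:Z).
  apply: (iter_path (p := p)); last by lia.
  - by rewrite -[p]addr0 f_fix //; lia.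
  - by rewrite -addrA f_fix //; lia.
  - move=> j jk; split; [apply: g_up|apply: g_down]; lia.
  - move=> j jk; have fj : f (p + 2 * j%:Z + 1) = p + 2 * j%:Z + 1 + 1.
      have cj : col (p + 2 * j%:Z + 1) = a.
        by rewrite -addrA colE; [case: ifP; [lia|case: ifP => //; lia]|lia].
      by rewrite /f -{1}cj flip_up.
    have -> : p + 2 * j%:Z + 2 = p + 2 * j%:Z + 1 + 1 by lia.
    by split=> //; rewrite -fj /f flipK.
apply: iter_even_fix; first by rewrite odd_double.
rewrite /= def_i; case r2 : (2 %| r)%Z.
  rewrite g_up // -addrA f_fix; [|lia|lia].
  by rewrite addrA g_down // f_fix //; lia.
have -> : r = r - 1 + 1 by lia.
rewrite addrA g_down; [|lia|lia].
rewrite f_fix; [|lia|lia].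
by rewrite g_up ?[in LHS]addrA -?[in LHS]addrA ?f_fix //; lia.
Qed.

End TwoRuns.

Lemma flip_shift (S : eqType) (c : int -> S) d s i :
  flip (fun j => c (j + d)) s i = flip c s (i + d) - d.
Proof.
by rewrite /flip [i - 1 + d]addrAC; do !case: ifP => _; lia.
Qed.

Lemma iter_flip_shift (S : eqType) (c : int -> S) d s t m i :
  iter m (flip (fun j => c (j + d)) s \o flip (fun j => c (j + d)) t) i =
  iter m (flip c s \o flip c t) (i + d) - d.
Proof.
elim: m => [|m IHm] /=; first by rewrite addrK.
by rewrite IHm !flip_shift !subrK.
Qed.

(** Even edges are flipped by [b] and odd ones by the product of [a] and [c]. This product is an
    involution, which settles the relation between [a] and [c] as all labels are even; vertices
    other than [a], [b], [c] act trivially. *)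
Lemma corner_virtually_surjects (Gamma : coxeterGraph) (a b c : Gamma) :
    even_coxeter Gamma -> a != c -> adjacent a b -> adjacent c b ->
    label [set a; b]%SET != 2%N -> label [set c; b]%SET != 2%N ->
  forall (K : groupType) (x y : K), (x * x = 1)%g -> (y * y = 1)%g ->
    (forall P : K -> Prop, P 1%g -> (forall z, P z -> P (x * z)%g) ->
      (forall z, P z -> P (y * z)%g) -> forall z, P z) ->
  virtually_surjects_onto (groupAut (coxeterGroup Gamma)) K.
Proof.
move=> Geven ac adj_ab adj_cb ab_ne2 cb_ne2 K x y.
have ab := adjacent_neq adj_ab; have cb := adjacent_neq adj_cb.
have [k k1 ab2k] : exists2 k, (1 < k)%N & label [set a; b]%SET = k.*2.
  exists (label [set a; b]%SET)./2; last by rewrite even_halfK // Geven.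
  by have := Geven _ adj_ab; have := label_ge2 adj_ab; lia.
have [l l1 cb2l] : exists2 l, (1 < l)%N & label [set c; b]%SET = l.*2.
  exists (label [set c; b]%SET)./2; last by rewrite even_halfK // Geven.
  by have := Geven _ adj_cb; have := label_ge2 adj_cb; lia.
(* By [two_runs_sym] the colouring is symmetric about [k - 1]; the shift by [d] will move this
   centre to 0. *)
pose col := two_runs b k l a c; pose d := k%:Z - 1.
have col_adj i : col i != col (i + 1) by apply: two_runs_adj.
have col_even i : (2 %| i)%Z -> col i = b by rewrite /col /two_runs => ->.
have col_odd i : (2 %| i)%Z = false -> col i = a \/ col i = c.
  by rewrite /col /two_runs => ->; case: ifP; [left|right].
have flip_b i : flip col b i = if (2 %| i)%Z then i + 1 else i - 1.
  case: ifPn => i2; first by rewrite -{1}(col_even _ i2) flip_up.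
  by rewrite flip_down // col_even //; lia.
have flip_even s i : s != b -> (2 %| i)%Z ->
    flip col s i = if col (i - 1) == s then i - 1 else i.
  by move=> sb i2; rewrite /flip (col_even _ i2) eq_sym (negPf sb).
have flip_odd s i : s != b -> (2 %| i)%Z = false ->
    flip col s i = if col i == s then i + 1 else i.
  move=> sb i2; rewrite /flip [col (i - 1)]col_even; last lia.
  by rewrite [b == s]eq_sym (negPf sb).
have flip_pair s t i : s != b -> t != b -> s != t ->
    (forall j, (2 %| j)%Z = false -> col j = s \/ col j = t) ->
    flip col s (flip col t i) = if (2 %| i)%Z then i - 1 else i + 1.
  move=> sb tb /negPf st col_st; case i2: (2 %| i)%Z.
    have i12 : (2 %| i - 1)%Z = false by lia.
    rewrite (flip_even t) //; have [ct|ct] := eqVneq (col (i - 1)) t.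
      by rewrite flip_odd // ct eq_sym st.
    by rewrite flip_even //; case: (col_st _ i12) => [->|ct'];
      [rewrite eqxx|rewrite ct' eqxx in ct].
  rewrite (flip_odd t) //; have [ct|ct] := eqVneq (col i) t.
    by rewrite flip_even ?addrK ?ct ?[t == s]eq_sym ?st //; lia.
  by rewrite flip_odd //; case: (col_st _ i2) => [->|ct'];
    [rewrite eqxx|rewrite ct' eqxx in ct].
have flip_ac i : flip col a (flip col c i) = if (2 %| i)%Z then i - 1 else i + 1.
  exact: flip_pair.
have flip_ca i : flip col c (flip col a i) = if (2 %| i)%Z then i - 1 else i + 1.
  by apply: flip_pair => //; [rewrite eq_sym|move=> j /col_odd[]; [right|left]].
have flip_out s i : s != a -> s != b -> s != c -> flip col s i = i.
  move=> sa sb sc; apply: flip_fix; rewrite /col /two_runs;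
    by do 2?case: ifP => _; rewrite eq_sym.
have order_ab i : iter k.*2 (flip col a \o flip col b) i = i.
  exact: two_runs_order.
have order_cb i : iter l.*2 (flip col c \o flip col b) i = i.
  have colE : two_runs b l k c a = fun j => col (j + (2 * k%:Z - 2)).
    by apply/funext => j; rewrite /col two_runs_swap.
  have := @two_runs_order _ b l k c a (i - (2 * k%:Z - 2)) l1 k1 cb ab.
  rewrite colE iter_flip_shift subrK => /(_ _)/(congr1 (fun j => j + (2 * k%:Z - 2))).
  by rewrite !subrK; apply; rewrite eq_sym.
have col_rel (s t : Gamma) : adjacent s t ->
    forall i, iter (label [set s; t]%SET) (flip col s \o flip col t) i = i.
  move=> st i; have s_ne_t := adjacent_neq st; have st_even := Geven _ st.
  have swap (u v : Gamma) m : (forall j, iter m (flip col u \o flip col v) j = j) ->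
      iter m (flip col v \o flip col u) i = i.
    by move=> uv; apply: iter_invol_swap uv _; apply: flipK.
  have out_l u v : u != a -> u != b -> u != c ->
      flip col u (flip col v (flip col u (flip col v i))) = i.
    by move=> ua ub uc; rewrite !(flip_out u) // flipK.
  have out_r u v : v != a -> v != b -> v != c ->
      flip col u (flip col v (flip col u (flip col v i))) = i.
    by move=> ua ub uc; rewrite !(flip_out v) // flipK.
  have [s_b|sb] := eqVneq s b.
    have tb : t != b by rewrite -s_b eq_sym.
    have [t_a|ta] := eqVneq t a.
      by rewrite s_b t_a finset.setUC ab2k; apply: swap.
    have [t_c|tc] := eqVneq t c.
      by rewrite s_b t_c finset.setUC cb2l; apply: swap.
    by apply: iter_even_fix; rewrite //= out_r.
  have [t_b|tb] := eqVneq t b.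
    have [s_a|sa] := eqVneq s a; first by rewrite s_a t_b ab2k.
    have [s_c|sc] := eqVneq s c; first by rewrite s_c t_b cb2l.
    by apply: iter_even_fix; rewrite //= out_l.
  apply: iter_even_fix => //=.
  have [s_a|sa] := eqVneq s a.
    have [t_c|tc] := eqVneq t c; first by rewrite s_a t_c !flip_ac; do 2!case: ifP; lia.
    by apply: out_r; rewrite // -s_a eq_sym.
  have [s_c|sc] := eqVneq s c; last exact: out_l.
  have [t_a|ta] := eqVneq t a; first by rewrite s_c t_a !flip_ca; do 2!case: ifP; lia.
  by apply: out_r; rewrite // -s_c eq_sym.
pose c0 i := col (i + d).
have c0_adj i : c0 i != c0 (i + 1) by rewrite /c0 addrAC.
have c0_rel (s t : Gamma) : adjacent s t ->
    forall i, iter (label [set s; t]%SET) (flip c0 s \o flip c0 t) i = i.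
  by move=> st i; rewrite iter_flip_shift col_rel // addrK.
have act_gen := line_act_gen c0_adj (coxeter_relator_flip c0_adj c0_rel).
have act_mul := line_actM c0_adj (coxeter_relator_flip c0_adj c0_rel).
pose W := coxeterGroup Gamma.
pose gb : W := pres_gen _ b; pose gac : W := (pres_gen _ a * pres_gen _ c)%g.
have act_b i : line_act c0 gb i = if (2 %| i + d)%Z then i + 1 else i - 1.
  by rewrite act_gen flip_shift flip_b; case: ifP => _; lia.
have act_ac i : line_act c0 gac i = if (2 %| i + d)%Z then i - 1 else i + 1.
  by rewrite act_mul !act_gen !flip_shift subrK flip_ac; case: ifP => _; lia.
(* The parity of [d] decides which of [gb] and [gac] flips the even edges of the shifted line. *)
have [u [v [u_e u_o v_e v_o]]] : exists u v : W,
  [/\ forall i, line_act c0 u (2 * i) = 2 * i + 1,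
      forall i, line_act c0 u (2 * i + 1) = 2 * i,
      forall i, line_act c0 v (2 * i) = 2 * i - 1
    & forall i, line_act c0 v (2 * i + 1) = 2 * i + 2].
  case k2 : (2 %| d)%Z; [exists gb, gac|exists gac, gb]; split=> i;
    rewrite ?act_b ?act_ac; case: ifP; lia.
apply: (coxeter_line_virtually_surjects c0_adj c0_rel (h := (k + l - 2)%N)
  _ _ _ u_e u_o v_e v_o); first lia.
- by move=> i; rewrite /c0 addrAC /col two_runs_per.
- move=> i; rewrite /c0 /col -[RHS]two_runs_sym //.
  by congr (two_runs b k l a c); rewrite /d; lia.
Qed.

(** * Complete even graphs with a matching of labels > 2 *)

Section MatchingFinite.
Variable Gamma : coxeterGraph.
Local Notation W := (coxeterGroup Gamma).
Local Notation gen := (pres_gen (@coxeter_relators Gamma)).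
Hypothesis complete : forall s t : Gamma, s != t -> adjacent s t.
Hypothesis matching : forall b a c : Gamma, a != b -> c != b ->
  label [set a; b]%SET != 2%N -> label [set c; b]%SET != 2%N -> a = c.

Lemma label2_commute (s t : Gamma) : s != t ->
  label [set s; t]%SET = 2%N -> commute (gen s) (gen t).
Proof.
move=> st l2; have := coxeter_relation (complete st).
rewrite l2 expgS expg1 /commute => e.
apply: (mulIg (gen s * gen t)%g); rewrite e.
by rewrite -mulgA [(gen s * (gen s * _))%g]mulgA coxeter_genK mul1g coxeter_genK.
Qed.

(** The partner of [s] in the matching, with [s] itself as default when [s] is unmatched. *)
Definition mate (s : Gamma) : Gamma :=
  odflt s [pick t | (t != s) && (label [set t; s]%SET != 2%N)].

Lemma mate_commute s t : t != s -> t != mate s -> commute (gen t) (gen s).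
Proof.
move=> ts; rewrite /mate; case: pickP => [u /andP[us lu] /= tu|none _].
  apply: label2_commute => //; apply/eqP/negPn/negP => lt.
  by rewrite (matching ts us lt lu) eqxx in tu.
by apply: label2_commute => //; apply/eqP; have := none t; rewrite ts /= => /negbFE.
Qed.

(** The defining relation of partners is symmetric, and by the matching condition partners are
    unique, so [mate] is an involution. *)
Lemma mate_mate s t : t != s -> t != mate s -> t != mate (mate s).
Proof.
rewrite /mate; case: pickP => [u /andP[us lu] /=|none /=] ts tu; last first.
  by case: pickP => [u|//]; rewrite none.
case: pickP => [w /andP[wu lw] /=|//].
rewrite (matching wu _ lw (c := s)) //; first by rewrite eq_sym.
by rewrite finset.setUC.
Qed.

(** Normal forms of the dihedral subgroup generated by [s] and its partner. The exponent is not
    reduced modulo the order of the rotation; [mate_dihedral_finite] does this. *)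
Definition mate_dihedral (s : Gamma) : set W :=
  [set ((gen s * gen (mate s)) ^+ i.1 * gen s ^+ i.2)%g | i in [set: nat * bool]].

Lemma mate_order s : exists2 m, (0 < m)%N & ((gen s * gen (mate s)) ^+ m = 1)%g.
Proof.
have [ms|ms] := eqVneq s (mate s).
  by exists 1%N; rewrite // -ms expg1 coxeter_genK.
have adj := complete ms; exists (label [set s; mate s]%SET).
  by have := label_ge2 adj; lia.
exact: coxeter_relation.
Qed.

Lemma mate_dihedral_finite s : finite_set (mate_dihedral s).
Proof.
have [m m_gt0 order] := mate_order s.
apply: (@sub_finite_set _ _
  [set ((gen s * gen (mate s)) ^+ nat_of_ord i.1 * gen s ^+ nat_of_bool i.2)%g
    | i in [set: 'I_m * bool]]); last exact/finite_image/finite_finset.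
move=> _ [[i e] _ <-] /=.
exists (Ordinal (ltn_pmod i m_gt0), e) => //=.
congr (_ * _)%g; rewrite {2}(divn_eq i m) mulnC expgnDr expgnA order.
by rewrite expg1n mul1g.
Qed.

Lemma mate_dihedral1 s : mate_dihedral s 1%g.
Proof. by exists (0%N, false) => //=; rewrite mulg1. Qed.

Lemma mate_dihedralM s t x : t = s \/ t = mate s ->
  mate_dihedral s x -> mate_dihedral s (x * gen t)%g.
Proof.
case=> -> [[i e] _ <-] /=.
  exists (i, ~~ e) => //=; case: e => /=; last by rewrite mulg1.
  by rewrite mulg1 expg1 -mulgA coxeter_genK mulg1.
case: e; first by exists (i.+1, false); rewrite //= mulg1 expg1 expgSr !mulgA.
have [m m_gt0 order] := mate_order s.
(* The power [m - 1] of the rotation is its inverse, [gen (mate s) * gen s]. *)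
exists ((i + m.-1)%N, true) => //=; rewrite expg1 mulg1.
have prev : ((gen s * gen (mate s)) ^+ m.-1 * gen s = gen (mate s))%g.
  apply: (mulIg (gen (mate s))); rewrite coxeter_genK -[RHS]order.
  by rewrite -{2}(prednK m_gt0) expgSr mulgA.
by rewrite expgnDr -mulgA prev.
Qed.

Lemma mate_dihedral_commute s t x : t != s -> t != mate s ->
  mate_dihedral s x -> commute x (gen t).
Proof.
move=> ts tm [[i e] _ <-]; apply: commute_sym; apply: commuteM; last first.
  exact/commuteX/mate_commute.
by apply/commuteX/commuteM; apply: mate_commute => //; apply: mate_mate.
Qed.

(** A matched pair may contribute twice, once from each end, which does not affect finiteness. *)
Fixpoint mate_products (l : seq Gamma) : set W :=
  if l is s :: l' then
    [set (x * y)%g | x in mate_products l' & y in mate_dihedral s]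
  else [set 1%g].

Lemma mate_products_finite l : finite_set (mate_products l).
Proof.
elim: l => [|s l IHl]; first exact: finite_set1.
exact/finite_image2/mate_dihedral_finite.
Qed.

Lemma mate_products1 l : mate_products l 1%g.
Proof.
elim: l => [//|s l IHl]; exists 1%g => //; exists 1%g; rewrite ?mulg1 //.
exact: mate_dihedral1.
Qed.

(** The new generator is absorbed by the last factor if [t] is [s] or its partner; otherwise it
    commutes with that factor and moves inward. *)
Lemma mate_productsM l t x :
  t \in l -> mate_products l x -> mate_products l (x * gen t)%g.
Proof.
elim: l x => [//|s l IHl] _ t_in [x lx [y sy <-]].
have [ts|ts] := eqVneq t s.
  exists x => //; exists (y * gen t)%g; last by rewrite mulgA.
  by apply: mate_dihedralM sy; left.
have [tm|tm] := eqVneq t (mate s).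
  exists x => //; exists (y * gen t)%g; last by rewrite mulgA.
  by apply: mate_dihedralM sy; right.
exists (x * gen t)%g; first by apply: IHl => //; rewrite inE (negPf ts) in t_in.
exists y => //; rewrite -!mulgA; congr (_ * _)%g.
exact/esym/(mate_dihedral_commute ts tm).
Qed.

Lemma matching_finite : finite_set [set: W].
Proof.
apply: sub_finite_set (mate_products_finite (enum Gamma)) => x _.
(* Products absorb generators on the right while [coxeter_ind] adds them on the left, hence the
   passage to inverses. *)
rewrite -[x]invgK; elim/coxeter_ind: (x^-1)%g => [|s y IHy].
  rewrite invg1; exact: mate_products1.
by rewrite invgM (mul1_invg (coxeter_genK s)); apply: mate_productsM; rewrite ?mem_enum.
Qed.

End MatchingFinite.

(** * The target groups *)

Section FreeProductZ2.
Local Notation K := (freeprod 'Z_2 'Z_2).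
Local Notation gen := (pres_gen (@freeprod_relators 'Z_2 'Z_2)).

Lemma freeprod_genl (x y : 'Z_2) : (gen (inl x) * gen (inl y))%g = gen (inl (x * y)%g).
Proof.
apply: (mulIg (gen (inl (x * y)%g))^-1%g); rewrite mulgV.
rewrite -(pres_class_letter _ _ true) -!(pres_class_letter _ _ false).
rewrite -![(_ * _)%g]/(pres_mul _ _) !pres_class_cat.
by apply/pres_classP/pres_eq_relator; left; exists x, y.
Qed.

Lemma freeprod_genr (x y : 'Z_2) : (gen (inr x) * gen (inr y))%g = gen (inr (x * y)%g).
Proof.
apply: (mulIg (gen (inr (x * y)%g))^-1%g); rewrite mulgV.
rewrite -(pres_class_letter _ _ true) -!(pres_class_letter _ _ false).
rewrite -![(_ * _)%g]/(pres_mul _ _) !pres_class_cat.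
by apply/pres_classP/pres_eq_relator; right; exists x, y.
Qed.

(** Both elements are idempotent. *)
Lemma freeprod_gen1 : gen (inl 1%g) = 1%g /\ gen (inr 1%g) = 1%g.
Proof.
split; [apply: (mulIg (gen (inl 1%g)))|apply: (mulIg (gen (inr 1%g)))];
  by rewrite mul1g ?freeprod_genl ?freeprod_genr mul1g.
Qed.

(** The group law of ['Z_2] is addition of residues, so [1%g] is the residue 0 and [t] the
    nontrivial element. *)
Let t : 'Z_2 := inZp 1.
Let tt1 : (t * t = 1)%g. Proof. exact/val_inj. Qed.
Let Z2_cases (x : 'Z_2) : x = 1%g \/ x = t.
Proof. by case: x => [[|[|//]] x2]; [left|right]; apply/val_inj. Qed.

Lemma freeprod_invl : (gen (inl t) * gen (inl t) = 1)%g.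
Proof. by rewrite freeprod_genl tt1 freeprod_gen1.1. Qed.

Lemma freeprod_invr : (gen (inr t) * gen (inr t) = 1)%g.
Proof. by rewrite freeprod_genr tt1 freeprod_gen1.2. Qed.

Lemma freeprod_Z2_ind (P : K -> Prop) : P 1%g ->
  (forall x, P x -> P (gen (inl t) * x)%g) ->
  (forall x, P x -> P (gen (inr t) * x)%g) -> forall x, P x.
Proof.
move=> P1 Pl Pr.
apply: pres_ind => // -[] z x Px; have [->|->] := Z2_cases z;
  rewrite ?freeprod_gen1.1 ?freeprod_gen1.2 ?invg1 ?mul1g //.
- exact: Pl.
- exact: Pr.
- by rewrite (mul1_invg freeprod_invl); apply: Pl.
- by rewrite (mul1_invg freeprod_invr); apply: Pr.
Qed.

End FreeProductZ2.

Lemma edgeless (T : finType) (P : {set T} -> Prop) e : e \in finset.set0 -> P e.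
Proof. by rewrite inE. Qed.

Definition infinite_dihedral_graph : coxeterGraph :=
  @CoxeterGraph bool finset.set0 (fun=> 2%N) (@edgeless _ _) (@edgeless _ _).

(** On the alternating line the powers of the product of the two generators move 0 to all the points
    [2 m], so they are pairwise distinct. *)
Lemma infinite_dihedral_infinite : infinite_group (coxeterGroup infinite_dihedral_graph).
Proof.
pose G := infinite_dihedral_graph.
pose c : int -> G := alternating (true : G) (false : G).
have c_adj i : c i != c (i + 1).
  rewrite /c /alternating; have -> : (2 %| i + 1)%Z = ~~ (2 %| i)%Z by lia.
  by case: (2 %| i)%Z.
have c_rel (s t : G) : adjacent s t ->
    forall i, iter (label [set s; t]%SET) (flip c s \o flip c t) i = i.
  by rewrite /adjacent inE.
have rel := coxeter_relator_flip c_adj c_rel.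
pose x : coxeterGroup G := (pres_gen _ (false : G) * pres_gen _ (true : G))%g.
have xE (m : nat) : line_act c (x ^+ m)%g 0 = 2 * m%:Z.
  elim: m => [|m IHm]; first by rewrite (line_act1 c_adj rel).
  rewrite expgS !(line_actM c_adj rel) IHm !(line_act_gen c_adj rel).
  rewrite /flip /c /alternating.
  have -> : (2 %| 2 * m%:Z)%Z by lia.
  have -> : (2 %| 2 * m%:Z + 1)%Z = false by lia.
  by rewrite /=; lia.
move=> /(finite_image (fun g => `|line_act c g 0|%N./2)) fin.
apply: infinite_nat; apply: sub_finite_set fin => m _.
by exists (x ^+ m)%g; rewrite // xE; lia.
Qed.

Theorem corollary1p8 :
  (forall (Gamma : coxeterGraph) (v w : Gamma),
      v != w -> ~~ adjacent v w -> even_vertex v -> even_vertex w ->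
      virtually_surjects_onto (groupAut (coxeterGroup Gamma)) (freeprod 'Z_2 'Z_2))
  /\
  (forall Gamma : coxeterGraph,
      even_coxeter Gamma ->
      infinite_group (coxeterGroup Gamma) ->
      exists Gamma' : coxeterGraph,
        infinite_group (coxeterGroup Gamma') /\
        virtually_surjects_onto (groupAut (coxeterGroup Gamma)) (coxeterGroup Gamma')).
Proof.
split=> [Gamma v w vw vw_nadj v_even w_even|Gamma Geven Ginf].
  exact: (nonadjacent_virtually_surjects vw vw_nadj v_even w_even
    freeprod_invl freeprod_invr freeprod_Z2_ind).
pose D := infinite_dihedral_graph.
exists D; split; first exact: infinite_dihedral_infinite.
have genK (s : D) := coxeter_genK s.
have D_ind (P : coxeterGroup D -> Prop) : P 1%g ->
    (forall x, P x -> P (pres_gen _ (true : D) * x)%g) ->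
    (forall x, P x -> P (pres_gen _ (false : D) * x)%g) -> forall x, P x.
  by move=> P1 Pt Pf; apply: coxeter_ind => // -[].
have Veven (v : Gamma) : even_vertex v by move=> e /Geven.
have [complete|] := pselect (forall s t : Gamma, s != t -> adjacent s t); last first.
  move=> /existsNP[v /existsNP[w /not_implyP[vw /negP nadj]]].
  exact: (nonadjacent_virtually_surjects vw nadj (Veven v) (Veven w)
    (genK _) (genK _) D_ind).
have [matching|] := pselect (forall b a c : Gamma, a != b -> c != b ->
    label [set a; b]%SET != 2%N -> label [set c; b]%SET != 2%N -> a = c).
  by case: Ginf; apply: matching_finite.
move=> /existsNP[b /existsNP[a /existsNP[c]]].
move=> /not_implyP[ab /not_implyP[cb /not_implyP[lab /not_implyP[lcb /eqP ac]]]].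
exact: (corner_virtually_surjects Geven ac (complete _ _ ab) (complete _ _ cb)
  lab lcb (genK _) (genK _) D_ind).
Qed.
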